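(* Let $p$ be a prime, and let $c_1,\dots,c_p\in\mathbb{Z}_p$ satisfy $c_1+\cdots+c_{p-1}\not\equiv 0\pmod p$. Let $A=\mathrm{Circ}(0,\dots,0,1)$ and $B=\mathrm{Circ}(c_1,\dots,c_p)-D$ be $p\times p$ matrices over $\mathbb{Z}_p$. Then for every $c\in\mathbb{Z}_p^p$, the set $\mathbb{Z}_p^p$ with the operation $x*y=Ax+By+c$ is an affine latin rumple of order $p^p$.
   Context: $\mathbb{Z}_p$ is the field of integers modulo $p$. $\mathrm{Circ}(c_1,\dots,c_n)$ denotes the $n\times n$ circulant matrix with first row $(c_1,\dots,c_n)$, constant on all broken diagonals: its $(i,j)$ and $(i+1,j+1)$ entries agree, indices taken modulo $n$. $D=(d_{i,j})$ is the $p\times p$ matrix with $d_{i+1,i}=i$ for $i=1,\dots,p-1$ and $d_{i,j}=0$ otherwise (entries mod $p$). A left quasigroup is a binary algebra in which all left translations are bijections; a quasigroup is one in which also all right translations are bijections. A rumple is a left quasigroup whose squaring map is a bijection and which satisfies $(xy)(xz)=(yx)(yz)$ for all $x,y,z$. A latin rumple is a rumple that is a quasigroup. A binary algebra $(G,* )$ is affine if there exist an abelian group $(G,+)$, endomorphisms $\varphi,\psi$ of $(G,+)$ and $c\in G$ with $x*y=\varphi(x)+\psi(y)+c$ for all $x,y$. *)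

(* Defs.v *)
From HB Require Import structures.
From mathcomp Require Import all_boot all_order all_algebra.
Set Implicit Arguments.
Unset Strict Implicit.
Unset Printing Implicit Defensive.
Import GRing.Theory.
Local Open Scope ring_scope.

Section BinaryAlgebras.
Variables (T : Type) (op : T -> T -> T).

Definition left_quasigroup : Prop := forall x, bijective (op x).

Definition quasigroup : Prop :=
  left_quasigroup /\ forall y, bijective (fun x => op x y).

Definition rumple : Prop :=
  [/\ left_quasigroup,
      bijective (fun x => op x x)
    & forall x y z, op (op x y) (op x z) = op (op y x) (op y z)].

Definition latin_rumple : Prop := rumple /\ quasigroup.

(* G ranges over all abelian group structures carried by the type T itself. *)
Definition affine : Prop :=
  exists G : GRing.Zmodule.axioms_ T,
  let V : zmodType := GRing.Zmodule.Pack G in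
  exists (phi psi : {additive V -> V}) (c : V),
  forall x y : V, op x y = phi x + psi y + c.

End BinaryAlgebras.

Section Circulant.
Variables (R : Type) (n : nat).

(* The representative of j - i modulo n; i : 'I_n forces 0 < n. *)
Definition ord_diff (i j : 'I_n) : 'I_n :=
  Ordinal (ltn_pmod (j + (n - i)) (leq_ltn_trans (leq0n i) (ltn_ord i))).

Definition Circ (c : 'rV[R]_n) : 'M[R]_n := \matrix_(i, j) c 0 (ord_diff i j).

Lemma Circ_first_row (c : 'rV[R]_n) (i j : 'I_n) :
  i = 0%N :> nat -> Circ c i j = c 0 j.
Proof.
move=> i0; rewrite mxE; congr (c 0 _); apply: val_inj => /=.
by rewrite i0 subn0 modnDr modn_small.
Qed.

Lemma Circ_diag (c : 'rV[R]_n) (i j : 'I_n) :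
  Circ c (ordS i) (ordS j) = Circ c i j.
Proof.
rewrite !mxE; congr (c 0 _); apply: val_inj => /=.
have n0 : (0 < n)%N by apply: leq_ltn_trans (ltn_ord i).
apply/eqP; rewrite -(eqn_modDr (i.+1 %% n)).
rewrite -addnA subnK ?modnDr ?modn_mod; last exact/ltnW/ltn_pmod.
rewrite eq_sym modnDmr -addnA addnS subnK; last exact: ltnW.
by rewrite addnS -addSn modnDr.
Qed.

End Circulant.

(* Indices start at 0: the entry in row j + 1, column j is j + 1. *)
Definition Dmx (p : nat) : 'M['F_p]_p :=
  \matrix_(i, j) if i == j.+1 :> nat then j.+1%:R else 0.

(* Main.v *)
(* Let U be the cyclic shift, so that A = U^-1 and Circ(c) = g(U) with
   g = sum_k c_(k+1) X^k.  On F_p[u]/(u^p - 1), with U acting as multiplication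
   by u, the matrix -D is the derivation d/du; hence [B, U] = 1, which gives
   AB - BA = A^2, i.e. the rumple identity.  Jacobson's formula
   (x + y)^p = x^p + ad(x)^(p-1)(y) + y^p, applied to x = -D and y = g(U), gives
   B^p = 0 + g^((p-1))(U) + g(U)^p = (p-1)! c_p + sum_k c_k
       = c_1 + ... + c_(p-1),
   a nonzero scalar, so B is invertible.  Since A + B arises from B by replacing
   c_p with c_p + 1, it is invertible as well, so squaring is bijective. *)
Require Import Defs.
From mathcomp Require Import all_boot all_order all_algebra.
Set Implicit Arguments.
Unset Strict Implicit.
Unset Printing Implicit Defensive.
Import GRing.Theory.
Local Open Scope ring_scope.

(** * Iterated commutators and Jacobson's formula in characteristic $p$ *)

Definition lie (R : pzRingType) (x y : R) : R := x * y - y * x.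

(** Left and right multiplication by [x] commute, so this is the binomial expansion of a power of
    their difference. *)
Lemma iter_lie (R : pzRingType) (x y : R) n :
  iter n (lie x) y
    = \sum_(i < n.+1) (-1) ^+ i * (x ^+ (n - i) * y * x ^+ i) *+ 'C(n, i).
Proof.
elim: n => [|n IHn]; first by rewrite big_ord1 /= !expr0 !mul1r mulr1 bin0.
pose G i := (-1) ^+ i * (x ^+ (n.+1 - i) * y * x ^+ i).
have -> : \sum_(i < n.+2) G i *+ 'C(n.+1, i)
    = \sum_(i < n.+1) G i *+ 'C(n, i) + \sum_(i < n.+1) G i.+1 *+ 'C(n, i).
  have -> : \sum_(i < n.+1) G i *+ 'C(n, i) = \sum_(i < n.+2) G i *+ 'C(n, i).
    by rewrite [RHS]big_ord_recr /= bin_small // mulr0n addr0.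
  rewrite big_ord_recl [in RHS]big_ord_recl !bin0 -addrA -big_split.
  by congr (_ + _); apply: eq_bigr => i _; rewrite /= binS mulrnDr.
rewrite iterS IHn /lie mulr_sumr mulr_suml -sumrN.
congr (_ + _); apply: eq_bigr => i _; rewrite /G.
  rewrite mulrnAr !mulrA (commr_sign x) -(mulrA _ x) -exprS.
  by rewrite -subSn // -ltnS.
by rewrite subSS mulrnAl -mulNrn exprS mulN1r mulNr -!mulrA -exprSr.
Qed.

(** By Pascal's rule, two neighbouring entries of row $p-1$ add up to an entry of row $p$ that $p$
    divides, so the signs alternate. *)
Lemma bin_pred_prime_pchar (R : nzRingType) p i :
  p \in [pchar R] -> (i < p)%N -> 'C(p.-1, i)%:R = (-1) ^+ i :> R.
Proof.
move=> pcharR; elim: i => [|i IHi] ltip; first by rewrite bin0.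
have p_pr := pcharf_prime pcharR.
have /eqP : 'C(p, i.+1)%:R = 0 :> R.
  by apply/eqP; rewrite -(dvdn_pcharf pcharR) prime_dvd_bin.
rewrite -{1}(prednK (prime_gt0 p_pr)) binS natrD IHi 1?ltnW //.
by rewrite addr_eq0 exprS mulN1r => /eqP.
Qed.

(** The binomials cancel the signs; what is left is the sum that the Leibniz rule gives for the
    derivative of a $p$-th power. *)
Lemma iter_lie_pchar (R : nzRingType) (x y : R) p :
  p \in [pchar R] ->
  iter p.-1 (lie x) y = \sum_(i < p) x ^+ (p.-1 - i) * y * x ^+ i.
Proof.
move=> pcharR; have p_gt0 := prime_gt0 (pcharf_prime pcharR).
rewrite iter_lie prednK //; apply: eq_bigr => i _.
by rewrite -mulr_natl (bin_pred_prime_pchar pcharR) // mulrA -exprMn_comm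
   ?mulrNN ?mulr1 ?expr1n ?mul1r //; apply: commr_refl.
Qed.

Lemma derivX_noncomm (R : nzRingType) (q : {poly R}) n :
  (q ^+ n)^`() = \sum_(i < n) q ^+ (n.-1 - i) * q^`() * q ^+ i.
Proof.
elim: n => [|n IHn]; first by rewrite expr0 derivC big_ord0.
rewrite exprS derivM big_ord_recr /= subnn expr0 mul1r addrC; congr (_ + _).
rewrite IHn mulr_sumr; apply: eq_bigr => i _.
rewrite !mulrA -exprS; congr (_ ^+ _ * _ * _).
by case: n i {IHn} => [[]|n] //= i; rewrite subSn // -ltnS.
Qed.

Lemma size_exp_linear (R : nzRingType) (x y : R) n :
  (size ((x%:P + y%:P * 'X) ^+ n)%R <= n.+1)%N.
Proof.
elim: n => [|n IHn]; first by rewrite expr0 size_poly1.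
apply/leq_sizeP => -[|j] // ltnj; have /leq_sizeP h := IHn.
rewrite exprS mulrDl -mulrA coefD !coefCM coefXM /= !h ?mulr0 ?addr0 //.
exact: ltnW.
Qed.

Lemma coef0_exp_linear (R : nzRingType) (x y : R) n :
  ((x%:P + y%:P * 'X) ^+ n)`_0 = x ^+ n.
Proof.
elim: n => [|n IHn]; first by rewrite !expr0 coef1.
by rewrite !exprS mulrDl -mulrA coefD !coefCM coefXM /= mulr0 addr0 IHn.
Qed.

Lemma coefn_exp_linear (R : nzRingType) (x y : R) n :
  ((x%:P + y%:P * 'X) ^+ n)`_n = y ^+ n.
Proof.
elim: n => [|n IHn]; first by rewrite !expr0 coef1.
have /leq_sizeP h := size_exp_linear x y n.
by rewrite !exprS mulrDl -mulrA coefD !coefCM coefXM /= h // mulr0 add0r IHn.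
Qed.

(* The derivative in X of (x + y X)^p is the constant ad(x)^(p-1)(y), so in
   characteristic p the coefficients of degree 2, ..., p - 1 vanish; then X = 1. *)
Lemma Jacobson_pchar (R : nzRingType) (x y : R) p :
  p \in [pchar R] -> (forall k, GRing.comm y (iter k (lie x) y)) ->
  (x + y) ^+ p = x ^+ p + iter p.-1 (lie x) y + y ^+ p.
Proof.
move=> pcharR comm_y; have p_pr := pcharf_prime pcharR.
set q := x%:P + y%:P * 'X.
have q' : q^`() = y%:P.
  by rewrite derivD derivC add0r derivM derivC mul0r derivX add0r mulr1.
(* As $X$ is central, replacing [x] by [q] only adds the bracket of [y] with the previous iterate,
   times $X$; it vanishes by [comm_y]. *)
have lie_q k : iter k (lie q) y%:P = (iter k (lie x) y)%:P.
  elim: k => //= k ->; rewrite /lie polyCB !polyCM mulrDl mulrDr opprD addrACA.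
  rewrite -[y%:P * 'X * _]mulrA -commr_polyX !mulrA -!polyCM (comm_y k).
  by rewrite polyCM addrN addr0.
have dH : (q ^+ p)^`() = (iter p.-1 (lie x) y)%:P.
  rewrite derivX_noncomm q' -(iter_lie_pchar _ _ (p := p)) ?lie_q //.
  by rewrite pchar_poly.
have coefH k : (0 < k < p.-1)%N -> (q ^+ p)`_k.+1 = 0.
  case/andP=> k_gt0 ltkp; have := coef_deriv (q ^+ p) k.
  rewrite dH coefC gtn_eqF // => /esym H0.
  (* $k+1$ times the coefficient is 0, and a Bezout relation modulo $p$ makes $k+1$ invertible in
     [R]. *)
  have : coprime k.+1 p.
    rewrite coprime_sym prime_coprime // gtnNdvd //.
    by rewrite -(prednK (prime_gt0 p_pr)) ltnS.
  case/(coprimeP _ (ltn0Sn k)) => -[u v] /= uv.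
  have ukE : (u * k.+1 = 1 + v * p)%N.
    by rewrite -uv subnK //; apply: ltnW; rewrite -subn_gt0 uv.
  move/(congr1 (fun m => m%:R : R)) : ukE => ukE.
  rewrite natrM natrD [(v * p)%:R]natrM (pcharf0 pcharR) in ukE.
  rewrite mulr0 addr0 mulr1n in ukE.
  by rewrite -[LHS]mul1r -ukE -mulrA (mulr_natl _ k.+1) H0 mulr0.
have -> : (x + y) ^+ p = (q ^+ p).[1].
  rewrite horner_exp_comm; last by rewrite /comm_poly mul1r mulr1.
  by rewrite hornerD hornerC hornerMX hornerC mulr1.
rewrite (horner_coef_wide _ (size_exp_linear x y p)).
under eq_bigr do rewrite expr1n mulr1.
rewrite big_ord_recr /= coefn_exp_linear; congr (_ + _).
have := coef_deriv (q ^+ p) 0; rewrite dH coefC /= mulr1n => ->.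
have := prime_gt1 p_pr; case: p coefH {pcharR p_pr dH} => [|[|p]] //= coefH _.
rewrite !big_ord_recl /= coef0_exp_linear addrA big1 ?addr0 // => i _.
by rewrite coefH //= ltnS ltn_ord.
Qed.

(** * The cyclic shift $U$, circulants and the matrix $D$ *)

Definition shift_mx (R : nzRingType) n : 'M[R]_n.+1 :=
  \matrix_(i, j) ((i.+1 %% n.+1)%N == j)%:R.

Lemma shift_mxX (R : nzRingType) n k :
  shift_mx R n ^+ k = \matrix_(i, j) (((i + k) %% n.+1)%N == j)%:R.
Proof.
elim: k => [|k IHk]; apply/matrixP => i j.
  by rewrite expr0 !mxE addn0 modn_small.
rewrite exprSr IHk !mxE (bigD1 (inZp (i + k))) //= !mxE eqxx mul1r.
rewrite big1 ?addr0 => [|l /negPf neq_l]; last first.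
  by rewrite !mxE (_ : _ == _ = false) ?mul0r // -neq_l eq_sym.
by rewrite /= -addn1 modnDml addn1 addnS.
Qed.

Lemma shift_mx_order (R : nzRingType) n : shift_mx R n ^+ n.+1 = 1.
Proof.
by rewrite shift_mxX; apply/matrixP => i j; rewrite !mxE modnDr modn_small.
Qed.

Lemma ord_diff_eq n (i j k : 'I_n.+1) :
  (ord_diff i j == k) = (((i + k) %% n.+1)%N == j).
Proof.
have : (j + (n.+1 - i) == k %[mod n.+1])%N = (j == i + k %[mod n.+1])%N.
  by rewrite -[in LHS](eqn_modDr i) -addnA subnK ?modnDr 1?addnC // ltnW.
by rewrite -val_eqE /= !(modn_small (ltn_ord _)) => ->; rewrite eq_sym.
Qed.

(** $U^k$ is the indicator of the broken diagonal $j - i = k$ modulo $n+1$, on which the circulant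
    is constant. *)
Lemma Circ_horner (R : comNzRingType) n (a : 'rV[R]_n.+1) :
  Circ a = horner_mx (shift_mx R n) (\poly_(k < n.+1) a 0 (inord k)).
Proof.
rewrite poly_def rmorph_sum /=; apply/matrixP => i j; rewrite summxE mxE.
move: (ord_diff i j) (ord_diff_eq i j) => k0 k0E.
rewrite (bigD1 k0) //= big1 => [|k].
  rewrite addr0 linearZ /= rmorphXn /= horner_mx_X mxE shift_mxX mxE.
  by rewrite -k0E eqxx mulr1 inord_val.
rewrite eq_sym k0E => /negPf neq_k.
by rewrite linearZ /= rmorphXn /= horner_mx_X mxE shift_mxX mxE neq_k mulr0.
Qed.

(** This identifies the matrix $A$ as $U^n$, the inverse of $U$. *)
Lemma Circ_last (R : comNzRingType) n :
  Circ (\row_(j < n.+1) (if j.+1 == n.+1 then 1 else 0)) = shift_mx R n ^+ n.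
Proof.
rewrite shift_mxX; apply/matrixP => i j; rewrite !mxE eqSS.
by rewrite -[n in _ == n]/(val (@ord_max n)) val_eqE ord_diff_eq /=; case: eqP.
Qed.

(** Both products are diagonal: $UD$ is diag$(1,\dots,n,0)$ and $DU$ is diag$(0,1,\dots,n)$. They
    differ by 1 in each row, in the last one because $n+1=0$ in ['F_n.+1]. *)
Lemma lie_Dmx_shift_mx n :
  prime n.+1 -> lie (- Dmx n.+1) (shift_mx 'F_n.+1 n) = 1.
Proof.
move=> p_pr; apply/matrixP => i j; rewrite /lie mulNr mulrN opprK addrC.
rewrite !mxE (bigD1 (inZp i.+1)) //= !mxE eqxx mul1r big1 ?addr0; last first.
  move=> l /negPf neq_l.
  by rewrite !mxE (_ : _ == _ = false) ?mul0r // -neq_l eq_sym.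
have -> : \sum_k Dmx n.+1 i k * shift_mx 'F_n.+1 n k j
    = if i == j then (i : nat)%:R else 0.
  case: i => -[|i] lti /=.
    by rewrite big1 ?if_same // => k _; rewrite !mxE mul0r.
  rewrite (bigD1 (Ordinal (ltnW lti))) //= !mxE eqxx modn_small // big1 ?addr0.
    by rewrite -val_eqE /=; case: eqP; rewrite ?mulr1 ?mulr0.
  move=> k /negPf neq_k; rewrite !mxE eqSS (_ : _ == _ = false) ?mul0r //.
  by rewrite -neq_k eq_sym.
have := ltn_ord i; rewrite ltnS leq_eqVlt => /orP[/eqP ieq|lti].
  rewrite /= ieq modnn /=; case: eqP => _; last by rewrite subr0.
  by apply/eqP; rewrite sub0r eq_sym -addr_eq0 nat1r pchar_Fp_0.
rewrite /= modn_small // eqSS val_eqE; case: eqP => [->|_]; rewrite ?subr0 //.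
by rewrite -natr1 addrAC subrr add0r.
Qed.

(** Each factor $D$ moves the support one diagonal further down, so nothing is left at $k = n+1$. *)
Lemma DmxX_eq0 n k (i j : 'I_n.+1) :
  (i < j + k)%N -> (Dmx n.+1 ^+ k) i j = 0.
Proof.
elim: k i => [|k IHk] i lti.
  by rewrite expr0 mxE; case: eqP lti => // ->; rewrite addn0 ltnn.
rewrite exprS mxE big1 // => l _; rewrite mxE; case: eqP => [il|]; last first.
  by rewrite mul0r.
by rewrite IHk ?mulr0 //; move: lti; rewrite il addnS ltnS.
Qed.

(** [lie d] is a derivation with value 1 at [u], hence acts on polynomials in [u] as $d/dX$. *)
Lemma lie_horner_mx (R : comNzRingType) n (d u : 'M[R]_n.+1) (q : {poly R}) :
  lie d u = 1 -> lie d (horner_mx u q) = horner_mx u q^`().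
Proof.
move=> du; elim/poly_ind: q => [|q c IHq].
  by rewrite deriv0 rmorph0 /lie mulr0 mul0r subrr.
rewrite derivD derivC addr0 derivM derivX mulr1 !rmorphD !rmorphM /=.
rewrite horner_mx_X horner_mx_C -IHq.
rewrite -[X in _ = _ + X]mulr1 -du /lie mulrDr mulrDl opprD addrACA.
rewrite [d * c%:M]scalar_mxC subrr addr0.
by rewrite mulrBl mulrBr !mulrA addrA addrNK.
Qed.

(** * The $p$-th power of $B$ and its invertibility *)

Lemma Circ_sub_DmxX n (a : 'rV['F_n.+1]_n.+1) :
  prime n.+1 ->
  (Circ a - Dmx n.+1) ^+ n.+1 = (\sum_(i < n.+1 | (i.+1 < n.+1)%N) a 0 i)%:M.
Proof.
move=> p_pr; set q := \poly_(k < n.+1) a 0 (inord k).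
have pcharF := pchar_Fp p_pr.
have iterE k : iter k (lie (- Dmx n.+1)) (Circ a)
    = horner_mx (shift_mx 'F_n.+1 n) q^`(k).
  elim: k => [|k IHk]; first by rewrite Circ_horner.
  by rewrite iterS IHk derivnS lie_horner_mx ?lie_Dmx_shift_mx.
rewrite addrC Jacobson_pchar; first last.
- by move=> k; rewrite iterE Circ_horner /GRing.comm -!rmorphM mulrC.
- by rewrite pchar_lalg.
rewrite (_ : (- _) ^+ _ = 0); last first.
  rewrite exprNn (_ : Dmx _ ^+ _ = 0) ?mulr0 //; apply/matrixP => i j.
  by rewrite DmxX_eq0 ?mxE // (leq_trans (ltn_ord i)) // leq_addl.
rewrite add0r iterE.
(* Since [q] has degree at most $n$, only $n!$ times its top coefficient survives, and $n! = -1$ by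
   Wilson. *)
have -> : q^`(n) = (- a 0 ord_max)%:P.
  apply/polyP => i; rewrite coef_derivn coefC coef_poly.
  case: i => [|i]; last by rewrite addnS ltnS ltnNge leq_addr mul0rn.
  rewrite addn0 ltnSn ffactnn -mulr_natr.
  have -> : n`!%:R = -1 :> 'F_n.+1.
    apply/eqP; rewrite -addr_eq0 natr1 -(dvdn_pcharf pcharF).
    by rewrite -Wilson ?prime_gt1.
  by rewrite mulrN1; congr (- a 0 _); apply: val_inj; exact: inordK.
rewrite horner_mx_C.
(* Frobenius is additive on polynomials, fixes the coefficients, and sends each $U^k$ to 1 because
   $U^p = 1$. *)
have -> : Circ a ^+ n.+1 = (\sum_i a 0 i)%:M.
  have pcharP : n.+1 \in [pchar {poly 'F_n.+1}] by rewrite pchar_poly.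
  rewrite Circ_horner -/q -rmorphXn /= -(pFrobenius_autE pcharP) /q poly_def.
  rewrite !rmorph_sum /=; apply: eq_bigr => i _.
  rewrite pFrobenius_autE -mul_polyC exprMn -polyC_exp rmorphM /= horner_mx_C.
  rewrite -exprM mulnC exprM !(rmorphXn (horner_mx _)) /= horner_mx_X.
  rewrite shift_mx_order expr1n mulr1 inord_val; congr (_%:M).
  by rewrite -[a 0 i]natr_Zp -(pFrobenius_autE pcharF) pFrobenius_aut_nat.
(* The derivative term cancels the last entry in the sum of all entries. *)
rewrite big_ord_recr raddfD /= addrC -addrA raddfN subrr addr0; congr (_%:M).
rewrite [RHS]big_mkcond big_ord_recr /= ltnn addr0.
apply: eq_bigr => i _; rewrite /= ltnS ltn_ord.
by congr (a 0 _); apply: val_inj.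
Qed.

Lemma Circ_sub_Dmx_unit n (a : 'rV['F_n.+1]_n.+1) :
  prime n.+1 -> \sum_(i < n.+1 | (i.+1 < n.+1)%N) a 0 i != 0 ->
  Circ a - Dmx n.+1 \in unitmx.
Proof.
move=> p_pr nz_a; have := Circ_sub_DmxX a p_pr; rewrite exprS => BX.
(* The inverse is $s^{-1}B^n$, where $s$ is the nonzero scalar $B^{n+1}$. *)
have [] // := @mulmx1_unit _ _ (Circ a - Dmx n.+1)
  ((\sum_(i < n.+1 | (i.+1 < n.+1)%N) a 0 i)^-1 *: (Circ a - Dmx n.+1) ^+ n).
by rewrite -scalemxAr [_ *m _]BX scale_scalar_mx mulVf.
Qed.

(** * Bijectivity of the translations and of squaring, and the rumple identity *)

Lemma mulmx_addr_bij (R : comUnitRingType) m n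
    (A : 'M[R]_m) (c : 'M[R]_(m, n)) :
  A \in unitmx -> bijective (fun x => A *m x + c).
Proof.
move=> uA; exists (fun y => invmx A *m (y - c)) => x.
  by rewrite addrK mulKmx.
by rewrite mulKVmx // subrK.
Qed.

Theorem corollary4p16 (p : nat) (hp : prime p) (a : 'rV['F_p]_p)
    (ha : \sum_(i < p | (i.+1 < p)%N) a 0 i != 0) (c : 'cV['F_p]_p) :
  let A : 'M['F_p]_p := Circ (\row_(j < p) (if j.+1 == p then 1 else 0)) in
  let B : 'M['F_p]_p := Circ a - Dmx p in
  let op := fun x y : 'cV['F_p]_p => A *m x + B *m y + c in
  [/\ affine op, latin_rumple op & #|{: 'cV['F_p]_p}| = (p ^ p)%N].
Proof.
case: p hp a ha c => // n p_pr a nz_a c.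
set e := \row_j _; move=> A B op.
pose U := shift_mx 'F_n.+1 n.
have AE : A = U ^+ n by apply: Circ_last.
have UA : U * A = 1 by rewrite AE -exprS shift_mx_order.
have AU : A * U = 1 by rewrite AE -exprSr shift_mx_order.
have unitA : A \in unitmx by have [] := mulmx1_unit AU.
have unitB : B \in unitmx by apply: Circ_sub_Dmx_unit.
have ABE : A + B = Circ (e + a) - Dmx n.+1.
  by rewrite addrA; congr (_ - _); apply/matrixP => i j; rewrite !mxE.
have unitAB : A + B \in unitmx.
  rewrite ABE; apply: Circ_sub_Dmx_unit => //.
  by rewrite (eq_bigr (a 0)) // => i lt_i; rewrite !mxE ltn_eqF ?add0r.
have lieBU : lie B U = 1.
  have CU : Circ a * U = U * Circ a.
    rewrite Circ_horner -[U in RHS]horner_mx_X -[X in _ * X](horner_mx_X U).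
    by rewrite -!rmorphM mulrC.
  by rewrite /lie mulrBl mulrBr CU opprB addrC addrA addrNK
     -(lie_Dmx_shift_mx p_pr) /lie mulrN mulNr opprK addrC.
clearbody A B.
(* Multiply $BU - UB = 1$ by $A = U^{-1}$ on both sides. *)
have lieAB : A * B - B * A = A * A.
  rewrite -[X in _ = X * _]mulr1 -lieBU /lie mulrBr mulrBl.
  by rewrite !mulrA AU mul1r -!mulrA UA mulr1.
have left_bij x : bijective (op x).
  apply: (eq_bij (mulmx_addr_bij (A *m x + c) unitB)) => y.
  by rewrite /op addrCA addrA.
split.
- exists (GRing.Zmodule.class 'cV['F_n.+1]_n.+1).
  by exists (mulmx A), (mulmx B), c.
- split; first split=> //.
  + apply: (eq_bij (mulmx_addr_bij c unitAB)) => x.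
    by rewrite /op mulmxDl.
  (* In $(xy)(xz)$ the coefficients of $x$ and $y$ are $A^2 + BA$ and $AB$. These agree by [lieAB],
     so swapping $x$ and $y$ changes nothing. *)
  + move=> x y z; rewrite /op.
    have mAB : A *m B = B *m A + A *m A by rewrite -[A *m A]lieAB addrC subrK.
    rewrite !mulmxDr !mulmxA mAB !mulmxDl; congr (_ + c).
    rewrite -!(addrA _ (B *m B *m z)) addrACA [RHS]addrACA; congr (_ + _).
    by rewrite addrAC [RHS]addrAC [RHS]addrC; congr (_ + _); apply: addrC.
  + split=> // y.
    apply: (eq_bij (mulmx_addr_bij (B *m y + c) unitA)) => x.
    by rewrite /op addrA.
- by rewrite card_mx card_Fp // muln1.
Qed.
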